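(* Let $\varphi$ be a symbol for $\mathcal{S}(\mathbb{R})$. If $C_\varphi:\mathcal{S}(\mathbb{R})\to\mathcal{S}(\mathbb{R})$, $f\mapsto f\circ\varphi$, is mean ergodic, then $\sigma(C_\varphi)\subset\overline{\mathbb{D}}$.
   Context: $\mathcal{S}(\mathbb{R})$ is the Schwartz space of smooth rapidly decreasing functions $f:\mathbb{R}\to\mathbb{C}$ with its usual Fréchet topology, given by the seminorms $\pi_n(f)=\sup_{x\in\mathbb{R}}\sup_{0\le j\le n}(1+|x|^2)^n|f^{(j)}(x)|$, $n\in\mathbb{N}$. A smooth function $\varphi:\mathbb{R}\to\mathbb{R}$ is a symbol for $\mathcal{S}(\mathbb{R})$ if $f\mapsto f\circ\varphi$ maps $\mathcal{S}(\mathbb{R})$ continuously into itself. A continuous linear operator $T:X\to X$ on a locally convex space is mean ergodic if the Cesàro means $T_{[n]}=\frac1n\sum_{k=1}^nT^k$ converge to a continuous linear operator $P$ in the strong operator topology, i.e. $T_{[n]}(x)\to P(x)$ for each $x\in X$. $\sigma(C_\varphi)$ is the set of all $\lambda\in\mathbb{C}$ such that $C_\varphi-\lambda\,\mathrm{Id}:\mathcal{S}(\mathbb{R})\to\mathcal{S}(\mathbb{R})$ does not admit a continuous linear inverse. $\mathbb{D}$ is the open unit disc in $\mathbb{C}$ and $\overline{\mathbb{D}}$ its closure. *)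

(* Defs.v *)
From HB Require Import structures.
From mathcomp Require Import all_boot all_order all_algebra complex.
From mathcomp Require Import all_classical all_reals all_analysis.

Set Implicit Arguments.
Unset Strict Implicit.
Unset Printing Implicit Defensive.

Import Order.TTheory GRing.Theory Num.Theory numFieldNormedType.Exports.

Local Open Scope classical_set_scope.
Local Open Scope ring_scope.
Local Open Scope complex_scope.

Section Operators.
Context (K : numFieldType) (X : tvsType K).
Implicit Types (T P S : X -> X).

Definition continuous_linear T : Prop := linear T /\ continuous T.

Definition cesaro_mean T (n : nat) : X -> X :=
  fun x => n%:R^-1 *: \sum_(1 <= k < n.+1) iter k T x.

Definition mean_ergodic T : Prop :=
  exists2 P, continuous_linear P &
    forall x : X, cesaro_mean T n x @[n --> \oo] --> P x.

Definition spectrum T : set K :=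
  [set l | ~ exists2 S, continuous_linear S &
             cancel (fun x => T x - l *: x) S /\
             cancel S (fun x => T x - l *: x)].

End Operators.

Section SchwartzFunctions.
Context {R : realType}.
Implicit Types (g h : R -> R) (f : R -> R[i]).

Definition smooth g : Prop := forall (n : nat) (x : R), derivable g^`(n)%classic x 1.

(* Complex-valued functions of a real variable are differentiated
   componentwise. *)
Definition csmooth f : Prop :=
  smooth (@complex.Re R \o f) /\ smooth (@complex.Im R \o f).

Definition cderivn (n : nat) f : R -> R[i] :=
  fun x => (@complex.Re R \o f)^`(n)%classic x +i* (@complex.Im R \o f)^`(n)%classic x.

Definition schwartz_values (n : nat) f : set R :=
  [set r | exists (x : R) (j : nat),
     (j <= n)%N /\ r = (1 + `|x| ^+ 2) ^+ n * Normc.normc (cderivn j f x)].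

Definition schwartz_seminorm (n : nat) f : R := sup (schwartz_values n f).

Definition is_schwartz f : Prop :=
  csmooth f /\ forall n : nat, has_ubound (schwartz_values n f).

Definition schwartz_pred : {pred R -> R[i]} := [pred f | `[< is_schwartz f >]].

Lemma schwartzP f : reflect (is_schwartz f) (f \in schwartz_pred).
Proof. exact: asboolP. Qed.

Lemma derive1n_lin a b g h : smooth g -> smooth h -> forall n,
  (fun x => a * g x + b * h x)^`(n)%classic =
  (fun x => a * g^`(n)%classic x + b * h^`(n)%classic x).
Proof.
move=> sg sh; elim=> [//|n IH].
rewrite derive1nS IH; apply/funext => x; rewrite !derive1nS !derive1E.
have da : derivable (a *: g^`(n)%classic) x 1 := derivableZ (sg n x).
have db : derivable (b *: h^`(n)%classic) x 1 := derivableZ (sh n x).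
by rewrite [LHS](deriveD da db) (deriveZ a (sg n x)) (deriveZ b (sh n x)).
Qed.

Lemma smooth_lin a b g h : smooth g -> smooth h ->
  smooth (fun x => a * g x + b * h x).
Proof.
move=> sg sh n x; rewrite (derive1n_lin a b sg sh).
have da : derivable (a *: g^`(n)%classic) x 1 := derivableZ (sg n x).
have db : derivable (b *: h^`(n)%classic) x 1 := derivableZ (sh n x).
exact: derivableD da db.
Qed.

Lemma ReZD (c : R[i]) f1 f2 : @complex.Re R \o (c *: f1 + f2) =
  (fun x => 1 * (complex.Re c * complex.Re (f1 x) +
                 - complex.Im c * complex.Im (f1 x)) + 1 * complex.Re (f2 x)).
Proof.
apply/funext => x /=; rewrite fctE /= !mul1r.
change ((c *: f1) x) with (c * f1 x).
by case: c (f1 x) (f2 x) => a b [c d] [e f] /=; rewrite mulNr.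
Qed.

Lemma ImZD (c : R[i]) f1 f2 : @complex.Im R \o (c *: f1 + f2) =
  (fun x => 1 * (complex.Re c * complex.Im (f1 x) +
                 complex.Im c * complex.Re (f1 x)) + 1 * complex.Im (f2 x)).
Proof.
apply/funext => x /=; rewrite fctE /= !mul1r.
change ((c *: f1) x) with (c * f1 x).
by case: c (f1 x) (f2 x) => a b [c d] [e f] /=.
Qed.

Lemma csmoothZD (c : R[i]) f1 f2 : csmooth f1 -> csmooth f2 ->
  csmooth (c *: f1 + f2).
Proof.
move=> [r1 i1] [r2 i2].
have l1 := @smooth_lin (complex.Re c) (- complex.Im c) _ _ r1 i1.
have l2 := @smooth_lin (complex.Re c) (complex.Im c) _ _ i1 r1.
split; first by rewrite ReZD; exact: (@smooth_lin 1 1 _ _ l1 r2).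
by rewrite ImZD; exact: (@smooth_lin 1 1 _ _ l2 i2).
Qed.

Lemma cderivnZD (c : R[i]) f1 f2 n x : csmooth f1 -> csmooth f2 ->
  cderivn n (c *: f1 + f2) x = c * cderivn n f1 x + cderivn n f2 x.
Proof.
move=> [r1 i1] [r2 i2]; rewrite /cderivn ReZD ImZD.
have l1 := @smooth_lin (complex.Re c) (- complex.Im c) _ _ r1 i1.
have l2 := @smooth_lin (complex.Re c) (complex.Im c) _ _ i1 r1.
rewrite (derive1n_lin 1 1 l1 r2) (derive1n_lin 1 1 l2 i2).
rewrite (derive1n_lin _ _ r1 i1) (derive1n_lin _ _ i1 r1) !mul1r.
by case: {l1 l2} c => a b /=; rewrite mulNr.
Qed.

Lemma csmooth0 : csmooth (0 : R -> R[i]).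
Proof.
have s0 : smooth (cst 0 : R -> R).
  move=> n x; suff -> : (cst 0 : R -> R)^`(n)%classic = cst 0.
    exact: derivable_cst.
  elim: n => [//|n IH]; rewrite derive1nS IH; apply/funext => y.
  by rewrite derive1_cst.
by split; exact: s0.
Qed.

Lemma cderivn0 n x : cderivn n (0 : R -> R[i]) x = 0.
Proof.
have := cderivnZD 1 n x csmooth0 csmooth0.
by rewrite scaler0 addr0 mul1r => /eqP; rewrite -subr_eq subrr eq_sym => /eqP.
Qed.

Lemma weight_ge0 n (x : R) : 0 <= (1 + `|x| ^+ 2) ^+ n.
Proof. by rewrite exprn_ge0// addr_ge0// exprn_ge0. Qed.

Lemma seminorm_ub n f x j : is_schwartz f -> (j <= n)%N ->
  (1 + `|x| ^+ 2) ^+ n * Normc.normc (cderivn j f x) <= schwartz_seminorm n f.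
Proof.
move=> [_ /(_ n) ub] jn; apply: ub_le_sup => //; by exists x, j.
Qed.

Lemma seminorm_le n f (C : R) :
  (forall x j, (j <= n)%N ->
    (1 + `|x| ^+ 2) ^+ n * Normc.normc (cderivn j f x) <= C) ->
  schwartz_seminorm n f <= C.
Proof.
move=> H; apply: ge_sup => [|_ [x [j [jn ->]]]]; last exact: H.
by eexists; exists 0, 0%N; split; last reflexivity.
Qed.

Lemma valueZD_le n c f1 f2 x j : is_schwartz f1 -> is_schwartz f2 ->
  (j <= n)%N ->
  (1 + `|x| ^+ 2) ^+ n * Normc.normc (cderivn j (c *: f1 + f2) x) <=
  Normc.normc c * schwartz_seminorm n f1 + schwartz_seminorm n f2.
Proof.
move=> s1 s2 jn; rewrite (cderivnZD c j x (proj1 s1) (proj1 s2)).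
have w0 := weight_ge0 n x.
apply: (@le_trans _ _ ((1 + `|x| ^+ 2) ^+ n *
  (Normc.normc (c * cderivn j f1 x) + Normc.normc (cderivn j f2 x)))).
  by rewrite ler_wpM2l// le_normcD.
rewrite mulrDr Normc.normcM mulrCA lerD//; last exact: seminorm_ub.
by rewrite ler_wpM2l ?seminorm_ub//; case: (c) => a b; exact: sqrtr_ge0.
Qed.

Lemma is_schwartzZD c f1 f2 : is_schwartz f1 -> is_schwartz f2 ->
  is_schwartz (c *: f1 + f2).
Proof.
move=> s1 s2; split; first exact: csmoothZD (proj1 s1) (proj1 s2).
move=> n; exists (Normc.normc c * schwartz_seminorm n f1 +
  schwartz_seminorm n f2) => _ [x [j [jn ->]]].
exact: valueZD_le.
Qed.

Lemma seminormZD_le n c f1 f2 : is_schwartz f1 -> is_schwartz f2 ->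
  schwartz_seminorm n (c *: f1 + f2) <=
  Normc.normc c * schwartz_seminorm n f1 + schwartz_seminorm n f2.
Proof. by move=> s1 s2; apply: seminorm_le => x j jn; exact: valueZD_le. Qed.

Lemma is_schwartz0 : is_schwartz 0.
Proof.
split; first exact: csmooth0.
by move=> n; exists 0 => _ [x [j [jn ->]]]; rewrite cderivn0 Normc.normc0 mulr0.
Qed.

Lemma schwartz_submod_closed : submod_closed schwartz_pred.
Proof.
split=> [|c f1 f2 /schwartzP s1 /schwartzP s2]; apply/schwartzP.
  exact: is_schwartz0.
exact: is_schwartzZD.
Qed.

HB.instance Definition _ :=
  GRing.isSubmodClosed.Build R[i] (R -> R[i]) schwartz_pred
    schwartz_submod_closed.

End SchwartzFunctions.

Record schwartz (R : realType) := Schwartz {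
  schwartz_fun :> R -> R[i];
  _ : schwartz_fun \in schwartz_pred }.

HB.instance Definition _ (R : realType) := [isSub for @schwartz_fun R].
HB.instance Definition _ (R : realType) := [Choice of schwartz R by <:].
HB.instance Definition _ (R : realType) :=
  [SubChoice_isSubLmodule of schwartz R by <:].

Section SchwartzTopology.
Context {R : realType}.
Local Notation S := (schwartz R).
Implicit Types (f g h : S).

Definition schwartz_ball (n : nat) f (e : R) : set S :=
  [set g | schwartz_seminorm n (g - f : S) < e].

(* The seminorms increase with [n], so the balls of single seminorms already
   form a neighbourhood base of the topology that they generate. *)
Definition schwartz_nbhs f : set_system S :=
  [set A | exists (n : nat) (e : R), 0 < e /\ schwartz_ball n f e `<=` A].

HB.instance Definition _ := hasNbhs.Build S schwartz_nbhs.

Lemma schwartz_is f : is_schwartz f.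
Proof. by apply/schwartzP; case: f. Qed.

Lemma piZD n c f g : schwartz_seminorm n (c *: f + g : S) <=
  Normc.normc c * schwartz_seminorm n f + schwartz_seminorm n g.
Proof. exact: seminormZD_le (schwartz_is f) (schwartz_is g). Qed.

Lemma pi0 n : schwartz_seminorm n (0 : S) = 0.
Proof.
have h0 x j : (1 + `|x| ^+ 2) ^+ n * Normc.normc (cderivn j (0 : S) x) = 0.
  by rewrite cderivn0 Normc.normc0 mulr0.
apply/eqP; rewrite eq_le; apply/andP; split.
  by apply: seminorm_le => x j jn; rewrite h0.
rewrite -(h0 0 0%N); exact/seminorm_ub/leq0n/schwartz_is.
Qed.

Lemma normc_ge0 (c : R[i]) : 0 <= Normc.normc c.
Proof. by case: c => a b; exact: sqrtr_ge0. Qed.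

Lemma pi_ge0 n f : 0 <= schwartz_seminorm n f.
Proof.
apply: le_trans (seminorm_ub 0 (schwartz_is f) (leq0n n)).
by rewrite mulr_ge0 ?weight_ge0 ?normc_ge0.
Qed.

Lemma piZ n c f :
  schwartz_seminorm n (c *: f : S) <= Normc.normc c * schwartz_seminorm n f.
Proof. by have := piZD n c f 0; rewrite pi0 !addr0. Qed.

Lemma piD n f g : schwartz_seminorm n (f + g : S) <=
  schwartz_seminorm n f + schwartz_seminorm n g.
Proof. by have := piZD n 1 f g; rewrite scale1r Normc.normc1 mul1r. Qed.

Lemma pi_mono m n f : (m <= n)%N ->
  schwartz_seminorm m f <= schwartz_seminorm n f.
Proof.
move=> mn; apply: seminorm_le => x j jm.
apply: le_trans (seminorm_ub x (schwartz_is f) (leq_trans jm mn)).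
rewrite ler_wpM2r ?normc_ge0// ler_weXn2l// lerDl exprn_ge0//.
Qed.

Lemma ball_center n f (e : R) : 0 < e -> schwartz_ball n f e f.
Proof. by rewrite /schwartz_ball /mkset subrr pi0. Qed.

Lemma schwartz_nbhs_filter f : ProperFilter (nbhs f).
Proof.
split; first by move=> [n [e [e0 /(_ f)]]]; apply; exact: ball_center.
split; first by exists 0%N, 1; split.
- move=> A B [n [e [e0 An]]] [m [d [d0 Bm]]].
  exists (maxn n m), (Order.min e d); rewrite lt_min e0 d0; split=> // g.
  rewrite /schwartz_ball /mkset lt_min => /andP[ge gd]; split.
    by apply: An; apply: le_lt_trans ge; exact/pi_mono/leq_maxl.
  by apply: Bm; apply: le_lt_trans gd; exact/pi_mono/leq_maxr.
- by move=> A B AB [n [e [e0 An]]]; exists n, e; split=> // g /An/AB.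
Qed.

Lemma schwartz_nbhs_singleton f (A : set S) : nbhs f A -> A f.
Proof. by move=> [n [e [e0]]]; apply; exact: ball_center. Qed.

Lemma ball_nbhs n f (e : R) g : schwartz_ball n f e g ->
  schwartz_nbhs g (schwartz_ball n f e).
Proof.
move=> fg; exists n, (e - schwartz_seminorm n (g - f)); split.
  by rewrite subr_gt0.
move=> h; rewrite /schwartz_ball /mkset => gh.
have -> : (h - f : S) = (h - g) + (g - f) by rewrite addrA subrK.
by apply: (le_lt_trans (piD _ _ _)); rewrite -ltrBrDr.
Qed.

Lemma schwartz_nbhs_nbhs f (A : set S) : nbhs f A -> nbhs f (nbhs^~ A).
Proof.
move=> [n [e [e0 An]]]; exists n, e; split=> // g /ball_nbhs[m [d [d0 gd]]].
by exists m, d; split=> //; exact: subset_trans An.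
Qed.

HB.instance Definition _ := Nbhs_isNbhsTopological.Build S
  schwartz_nbhs_filter schwartz_nbhs_singleton schwartz_nbhs_nbhs.

Lemma schwartz_add_continuous : continuous (fun x : S * S => x.1 + x.2).
Proof.
move=> [f g] A [n [e [e0 An]]].
exists (schwartz_ball n f (e / 2), schwartz_ball n g (e / 2)).
  by split; exists n, (e / 2); split=> //; rewrite divr_gt0.
move=> [f' g'] [/= ff gg]; apply: An; rewrite /schwartz_ball /mkset.
have -> : (f' + g' - (f + g) : S) = (f' - f) + (g' - g).
  by rewrite opprD addrACA.
by apply: (le_lt_trans (piD _ _ _)); rewrite [e]splitr ltrD.
Qed.

Lemma normc_lt (c : R[i]) (d : R) : `|c| < d%:C -> Normc.normc c < d.
Proof. by rewrite ltcR. Qed.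

Lemma scale_aux1 (x a e : R) :
  0 <= x -> 0 <= a -> x < e / 2 / (a + 1) -> x * a < e / 2.
Proof.
move=> x0 a0; rewrite ltr_pdivlMr ?ltr_wpDl// => h.
by apply: le_lt_trans h; rewrite ler_wpM2l// lerDl.
Qed.

Lemma scale_aux2 (b l e y : R) : 0 <= b -> 0 <= l -> l <= b + 1 ->
  0 <= y -> y < e / 2 / (b + 1) -> l * y <= e / 2.
Proof.
move=> b0 l0 lb y0 yl; have b1 : 0 < b + 1 by rewrite ltr_wpDl.
have -> : e / 2 = (b + 1) * (e / 2 / (b + 1)).
  by rewrite [RHS]mulrC divfK// gt_eqF.
exact: ler_pM l0 y0 lb (ltW yl).
Qed.

Lemma schwartz_scale_continuous :
  continuous (fun z : R[i]^o * S => z.1 *: z.2).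
Proof.
move=> [k f] A [n [e [e0 An]]].
pose a := schwartz_seminorm n f; have a0 : 0 <= a by exact: pi_ge0.
pose b := Normc.normc k; have b0 : 0 <= b by exact: normc_ge0.
pose d := Order.min 1 (e / 2 / (a + 1)).
pose d' := e / 2 / (b + 1).
have d0 : 0 < d by rewrite lt_min ltr01 !divr_gt0// ltr_wpDl.
have d'0 : 0 < d' by rewrite !divr_gt0// ltr_wpDl.
exists (ball (k : R[i]^o) d%:C, schwartz_ball n f d').
  split; last by exists n, d'; split.
  by apply: (@nbhsx_ballx R[i] R[i]^o); rewrite ltcR.
move=> [l g] [/= kl fg]; apply: An; rewrite /schwartz_ball /mkset.
have {}kl : Normc.normc (l - k) < d.
  by apply: normc_lt; rewrite -normrN opprB; move: kl; rewrite -ball_normE.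
have -> : (l *: g - k *: f : S) = (l - k) *: f + l *: (g - f).
  by rewrite scalerBl scalerBr [RHS]addrC addrA subrK.
apply: (le_lt_trans (piZD _ _ _ _)).
move: kl; rewrite lt_min => /andP[kl1 kla].
have lb : Normc.normc l <= b + 1.
  rewrite -[l](subrK k) (le_trans (le_normcD _ _))// addrC lerD2l.
  exact: ltW.
have h1 := scale_aux1 (normc_ge0 (l - k)) a0 kla.
have h2 := scale_aux2 b0 (normc_ge0 l) lb (pi_ge0 n (g - f : S)) fg.
rewrite [e]splitr; exact: ltr_leD h1 (le_trans (piZ n l (g - f : S)) h2).
Qed.

Lemma normc_conv (l : R[i]) : 0 <= l -> l <= 1 ->
  Normc.normc l + Normc.normc (1 - l) = 1.
Proof.
move=> l0 l1; apply: (@complexI R); rewrite rmorphD/=.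
change (`|l| + `|1 - l| = 1).
by rewrite !ger0_norm ?subr_ge0// addrC subrK.
Qed.

Lemma conv_lt (p q a b c e : R) : 0 <= p -> 0 <= q -> p + q = 1 ->
  a < e -> b < e -> c <= q * b -> p * a + c < e.
Proof.
move=> p0 q0 pq ae be cb.
have m_lt : Order.max a b < e by rewrite gt_max ae be.
apply: le_lt_trans m_lt; rewrite -[leRHS]mul1r -pq mulrDl lerD//.
  by rewrite ler_wpM2l// le_max lexx.
by apply: (le_trans cb); rewrite ler_wpM2l// le_max lexx orbT.
Qed.

Lemma ball_conv n f (e : R) g h (l : R[i]) : 0 <= l -> l <= 1 ->
  schwartz_ball n f e g -> schwartz_ball n f e h ->
  schwartz_ball n f e (l *: g + (1 - l) *: h).
Proof.
move=> l0 l1 ge he; rewrite /schwartz_ball /mkset.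
have -> : (l *: g + (1 - l) *: h - f : S) =
          l *: (g - f) + (1 - l) *: (h - f).
  have l1E : l + (1 - l) = 1 by rewrite addrC subrK.
  by rewrite !scalerBr addrACA -opprD -scalerDl l1E scale1r.
apply: (le_lt_trans (piZD n l (g - f : S) ((1 - l) *: (h - f) : S))).
exact: (conv_lt (normc_ge0 l) (normc_ge0 (1 - l)) (normc_conv l0 l1) ge he
  (piZ n (1 - l) (h - f : S))).
Qed.

Lemma schwartz_locally_convex :
  exists2 B : set_system S, (forall b, b \in B -> convex_set b) & basis B.
Proof.
exists [set B | exists n f e, B = schwartz_ball n f e].
  move=> _ /set_mem[n [f [e ->]]].
  apply/convex_setW => g h /set_mem ge /set_mem he l l0 l1; apply/mem_set.
  exact: (ball_conv (ltW l0) (ltW l1) ge he).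
split.
  move=> _ [n [f [e ->]]].
  by rewrite openE => g; exact: ball_nbhs.
move=> f A [n [e [e0 An]]]; exists (schwartz_ball n f e) => //; split.
  by exists n, f, e.
exact: ball_center.
Qed.

(* The factory [PreTopologicalLmod_isTvs] only builds the uniform structure. *)
HB.instance Definition _ := PreTopologicalLmod_isTvs.Build R[i] S
  schwartz_add_continuous schwartz_scale_continuous schwartz_locally_convex.
HB.instance Definition _ := PreTopologicalNmodule_isTopologicalNmodule.Build S
  schwartz_add_continuous.
HB.instance Definition _ := TopologicalNmodule_isTopologicalLmodule.Build R[i] S
  schwartz_scale_continuous.
HB.instance Definition _ := Uniform_isTvs.Build R[i] S schwartz_locally_convex.

End SchwartzTopology.

(* [R[i]^o] rather than [R[i]]: the former carries the library topology. *)
Definition unit_disc {R : realType} : set R[i]^o := [set z | `|z| < 1].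

Section CompositionOperator.
Context {R : realType}.
Implicit Types (phi : R -> R) (f : schwartz R).

(* [f \o phi] when this is a Schwartz function, and [0] otherwise. *)
Definition composition_op phi : schwartz R -> schwartz R :=
  fun f => insubd 0 (schwartz_fun f \o phi).

Definition is_symbol phi : Prop :=
  [/\ smooth phi,
      forall f, is_schwartz (schwartz_fun f \o phi) &
      continuous (composition_op phi)].

Lemma composition_opE phi f x : is_symbol phi ->
  composition_op phi f x = f (phi x).
Proof.
by case=> _ + _ => /(_ f)/schwartzP fphi; rewrite -[LHS]/(val _ x) insubdK.
Qed.

Lemma composition_op_linear phi : is_symbol phi -> linear (composition_op phi).
Proof.
move=> sphi c f g; apply/val_inj/funext => x.
change (composition_op phi (c *: f + g) x =
  c * composition_op phi f x + composition_op phi g x).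
by rewrite !composition_opE.
Qed.

End CompositionOperator.

(* Main.v *)
From HB Require Import structures.
Require Import Defs.
From mathcomp Require Import all_boot all_order all_algebra complex.
From mathcomp Require Import all_classical all_reals all_analysis.
From mathcomp Require Import lra ring.
Set Implicit Arguments.
Unset Strict Implicit.
Unset Printing Implicit Defensive.

Import Order.TTheory GRing.Theory Num.Theory numFieldNormedType.Exports.
Local Open Scope classical_set_scope.
Local Open Scope ring_scope.
Local Open Scope complex_scope.

(** The statement is an instance of a fact about Fréchet spaces: a continuous
linear operator [T] whose orbits grow subexponentially has no spectrum outside
the closed unit disc.

If the Cesàro means of [T] converge at [f], then
[T^(k+1) f = (k+1) T_[k+1] f - k T_[k] f] shows that every seminorm of [T^k f]
is [O(k+1)] ([mean_ergodic_growth]), hence [O(mu^k)] for every [mu > 1] by the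
Bernoulli inequality.  The constants depend on [f]; the Banach-Steinhaus
principle ([uniform_boundedness]) replaces them by one estimate
[pi_n (T^k f) <= C mu^k pi_m f].  For [1 < mu < |l|] the Neumann series
[sum_k l^-(k+1) T^k f] is then dominated by a geometric series, so it converges
to the value at [f] of a continuous inverse of [l - T]
([geometric_growth_not_spectrum]).

Both the Banach-Steinhaus principle and the Neumann series rest on the
completeness of the Schwartz space ([schwartz_complete]).  A Cauchy sequence
has pointwise limits of all derivatives, and these limits must be shown to be
derivatives of one another.  Since the second derivatives are uniformly
bounded, the Taylor remainder estimate
[|g y - g x - g' x (y - x)| <= C |y - x|^2] holds with the same [C] along the
sequence; it survives pointwise limits and forces differentiability of the
limit ([smooth_pointwise_limit]). *)

(** * Differentiating pointwise limits *)

(** Stating the position of the intermediate point as a distance to [x] makes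
the two orders of [x] and [y] one case. *)
Lemma mvt_dist (R : realType) (g : R -> R) (x y : R) :
  (forall z, derivable g z 1) ->
  exists2 c, `|c - x| <= `|y - x| & g y - g x = g^`()%classic c * (y - x).
Proof.
move=> dg.
have isd (z : R) : is_derive z 1 g (g^`()%classic z).
  by rewrite derive1E; exact: DeriveDef.
have cg a b : {within `[a, b], continuous g}.
  by apply: derivable_within_continuous => z _; exact: dg.
have [xy|/ltW yx] := leP x y.
  have [c] := MVT_segment xy (fun z _ => isd z) (cg x y).
  rewrite in_itv/= => /andP[xc cy] e; exists c => //.
  by rewrite !ger0_norm ?subr_ge0// lerD2r.
have [c] := MVT_segment yx (fun z _ => isd z) (cg y x).
rewrite in_itv/= => /andP[yc cx] e; exists c; last by lra.
by rewrite !ler0_norm ?subr_le0// lerN2 lerD2r.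
Qed.

(** The mean value theorem is used twice, for [g] on [x, y] and for its
derivative on [x, c], rather than a Taylor formula: the resulting constant is
[C] instead of [C / 2], which is harmless. *)
Lemma taylor1_bound (R : realType) (g : R -> R) (C x y : R) : smooth g ->
  (forall z, `|g^`(2)%classic z| <= C) ->
  `|g y - g x - g^`()%classic x * (y - x)| <= C * `|y - x| ^+ 2.
Proof.
move=> sg gC.
have [c cxy ->] := mvt_dist x y (sg 0%N).
have [d _ dE] := mvt_dist x c (sg 1%N).
rewrite -mulrBl dE normrM normrM expr2 mulrA ler_wpM2r//.
by apply: ler_pM => //; exact: gC.
Qed.

(** The error term is [o(y - x)], so the difference quotient, completed by [a] at
[x], is continuous there: the Carathéodory form of differentiability. *)
Lemma is_derive_quadratic (R : realType) (f : R -> R) (x a C : R) :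
  (forall y, `|f y - f x - a * (y - x)| <= C * `|y - x| ^+ 2) ->
  is_derive x 1 f a.
Proof.
move=> fC; apply/is_derive1_caratheodory.
exists (fun z => if z == x then a else (f z - f x) / (z - x)); split.
- move=> z; case: eqP => [->|/eqP]; first by rewrite !subrr mulr0.
  by rewrite -subr_eq0 => /divfK->.
- have dist_le z : `|a - (if z == x then a else (f z - f x) / (z - x))|
      <= `|C| * `|z - x|.
    case: eqP => [_|/eqP zx]; first by rewrite subrr normr0 mulr_ge0.
    have zx0 : 0 < `|z - x| by rewrite normr_gt0 subr_eq0.
    rewrite distrC -(ler_pM2r zx0) -normrM mulrBl divfK ?subr_eq0//.
    by rewrite -mulrA -expr2 (le_trans (fC z))// ler_wpM2r ?ler_norm// exprn_ge0.
  apply/cvgrPdist_lt => /= e e0; rewrite eqxx.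
  near=> z; apply: le_lt_trans (dist_le z) _.
  have C1 : 0 < `|C| + 1 by rewrite ltr_wpDl.
  apply: (@le_lt_trans _ _ ((`|C| + 1) * `|z - x|)).
    by rewrite ler_wpM2r// lerDl.
  rewrite mulrC -ltr_pdivlMr// distrC; near: z.
  by apply: (@cvgr_dist_lt _ R^o) => //; rewrite divr_gt0.
- by rewrite eqxx.
Unshelve. all: by end_near. Qed.

Lemma derive1n_add (R : realType) (g : R -> R) (m n : nat) :
  (g^`(m)^`(n) = g^`(m + n))%classic.
Proof. by rewrite /derive1n -iterD addnC. Qed.

(** Uniform bounds on the derivatives replace uniform convergence: the quadratic
Taylor estimate for [(u k)^`(j)] has a constant that does not depend on [k], so
it passes to the limit [k --> oo] at each pair of points. *)
Lemma smooth_pointwise_limit (R : realType) (u : nat -> R -> R)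
    (G : nat -> R -> R) :
  (forall k, smooth (u k)) ->
  (forall j x, (u k)^`(j)%classic x @[k --> \oo] --> G j x) ->
  (forall j, exists C : R,
     \forall k \near \oo, forall x, `|(u k)^`(j)%classic x| <= C) ->
  smooth (G 0%N) /\ forall j, (G 0%N)^`(j)%classic = G j.
Proof.
move=> su uG ub.
have dG j (x : R) : is_derive x 1 (G j) (G j.+1 x).
  have [C uC] := ub j.+2.
  apply: (@is_derive_quadratic _ _ _ _ C) => y.
  have lim_taylor : `|(u k)^`(j)%classic y - (u k)^`(j)%classic x -
       (u k)^`(j.+1)%classic x * (y - x)| @[k --> \oo] -->
       `|G j y - G j x - G j.+1 x * (y - x)|.
    apply: cvg_norm; apply: cvgB; first exact: cvgB.
    by apply: cvgM => //; exact: cvg_cst.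
  apply: (cvgr_to_le lim_taylor); near=> k.
  rewrite derive1nS.
  have sj : smooth ((u k)^`(j))%classic.
    by move=> n z; rewrite derive1n_add; exact: su.
  apply: (@taylor1_bound _ _ C x y sj) => z.
  rewrite derive1n_add addn2.
  by move: z; near: k.
have GE j : (G 0%N)^`(j)%classic = G j.
  elim: j => [//|j IH]; rewrite derive1nS IH; apply/funext => x.
  by rewrite derive1E; exact: (@derive_val _ _ _ _ _ _ _ (dG j x)).
by split=> // n x; rewrite GE; exact: (@ex_derive _ _ _ _ _ _ _ (dG n x)).
Unshelve. all: by end_near. Qed.

(** * The Schwartz space is a complete space *)

Lemma normc_Re_le (R : rcfType) (z : R[i]) : `|complex.Re z| <= Normc.normc z.
Proof. by rewrite -lecR; exact: normc_ge_Re. Qed.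

Lemma normc_Im_le (R : rcfType) (z : R[i]) : `|complex.Im z| <= Normc.normc z.
Proof.
by case: z => a b /=; rewrite -sqrtr_sqr ler_wsqrtr// lerDr sqr_ge0.
Qed.

Lemma cvg_normc (R : realType) (z : nat -> R[i]) (c : R[i]) :
  complex.Re (z k) @[k --> \oo] --> complex.Re c ->
  complex.Im (z k) @[k --> \oo] --> complex.Im c ->
  Normc.normc (z k) @[k --> \oo] --> Normc.normc c.
Proof.
have normcE (d : R[i]) : Normc.normc d =
    Num.sqrt (complex.Re d * complex.Re d + complex.Im d * complex.Im d).
  by case: d.
move=> re im; under eq_fun do rewrite normcE; rewrite normcE.
apply: continuous_cvg; first exact: sqrt_continuous.
by apply: cvgD; exact: cvgM.
Qed.

Section SchwartzLimits.
Context {R : realType}.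
Local Notation S := (schwartz R).
Local Notation pi := schwartz_seminorm.
Implicit Types (f g h : S) (u v : nat -> S).

Lemma cderivnB j f g x :
  cderivn j (f - g : S) x = cderivn j f x - cderivn j g x.
Proof.
have -> : schwartz_fun (f - g) = -1 *: schwartz_fun g + schwartz_fun f.
  by rewrite scaleN1r addrC.
rewrite cderivnZD; last 2 first.
- exact: (proj1 (schwartz_is g)).
- exact: (proj1 (schwartz_is f)).
by rewrite mulN1r addrC.
Qed.

Lemma normc_cderivn_le n j f x : (j <= n)%N ->
  Normc.normc (cderivn j f x) <= pi n f.
Proof.
move=> jn; apply: le_trans (seminorm_ub x (schwartz_is f) jn).
rewrite ler_peMl ?normc_ge0// exprn_ege1// lerDl exprn_ge0//.
Qed.

Lemma piN n f : pi n (- f : S) = pi n f.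
Proof.
suff le g : pi n (- g : S) <= pi n g.
  by apply/eqP; rewrite eq_le le -{1}[f]opprK le.
by have := piZ n (-1) g; rewrite scaleN1r normcN Normc.normc1 mul1r.
Qed.

Lemma piB n f g : pi n (f - g : S) <= pi n f + pi n g.
Proof. by rewrite -(piN n g); exact: piD. Qed.

Lemma piBC n f g : pi n (f - g : S) = pi n (g - f : S).
Proof. by rewrite -piN opprB. Qed.

Lemma piBD n h f g : pi n (f - g : S) <= pi n (f - h : S) + pi n (h - g : S).
Proof. by have := piD n (f - h) (h - g); rewrite addrA subrK. Qed.

(** The weight and the derivatives are trivial at index [0], so that seminorm is the
sup norm and the topology is Hausdorff. *)
Lemma pi_eq0 f : pi 0 f = 0 -> f = 0.
Proof.
move=> f0; apply/val_inj/funext => x /=.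
apply: Normc.eq0_normc; apply/eqP; rewrite eq_le normc_ge0 andbT.
have := @normc_cderivn_le 0%N 0%N f x (leqnn _).
by rewrite f0 /cderivn /=; case: (schwartz_fun f x).
Qed.

Lemma schwartz_cvgP u f :
  u @ \oo --> f <->
  forall n (e : R), 0 < e -> \forall k \near \oo, pi n (u k - f : S) < e.
Proof.
split=> [uf n e e0|H A [n [e [e0 An]]]].
  have nf : nbhs f (schwartz_ball n f e) by exists n, e; split.
  by have := uf _ nf; rewrite nbhs_filterE; exact.
by rewrite nbhs_filterE; apply: filterS (H n e e0) => k uk; exact: An.
Qed.

Lemma schwartz_cvg_squeeze u f :
  (forall n, exists2 b : nat -> R, b @ \oo --> (0 : R) &
     forall k, pi n (u k - f : S) <= b k) -> u @ \oo --> f.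
Proof.
move=> ub; apply/schwartz_cvgP => n e e0; have [b b0 {}ub] := ub n; near=> k.
apply: le_lt_trans (ub k) _; near: k; exact: (cvgr_lt 0).
Unshelve. all: by end_near. Qed.

Lemma seminorm_lim_le n u f g (C : R) : u @ \oo --> f ->
  (\forall k \near \oo, pi n (u k - g : S) <= C) -> pi n (f - g : S) <= C.
Proof.
move=> /schwartz_cvgP uf uC; apply/ler_addgt0Pr => e e0; near \oo => k.
rewrite [leRHS]addrC; apply: le_trans (piBD n (u k) f g) _.
apply: lerD; last by near: k.
by rewrite piBC ltW//; near: k; exact: uf.
Unshelve. all: by end_near. Qed.

Lemma schwartz_cvg_unique u f g : u @ \oo --> f -> u @ \oo --> g -> f = g.
Proof.
move=> uf ug; apply/eqP; rewrite -subr_eq0; apply/eqP/pi_eq0/eqP.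
rewrite eq_le Defs.pi_ge0 andbT; apply/ler_addgt0Pr => e e0; rewrite add0r.
apply: (seminorm_lim_le uf).
move/schwartz_cvgP: ug => /(_ 0%N e e0); apply: filterS => k; exact: ltW.
Qed.

Lemma schwartz_cvgZD (c : R[i]) u v f g : u @ \oo --> f -> v @ \oo --> g ->
  (fun k => c *: u k + v k) @ \oo --> c *: f + g.
Proof.
move=> /schwartz_cvgP uf /schwartz_cvgP vg; apply/schwartz_cvgP => n e e0.
have c1 : 0 < Normc.normc c + 1 by rewrite ltr_wpDl// normc_ge0.
near=> k.
have -> : (c *: u k + v k - (c *: f + g) : S) = c *: (u k - f) + (v k - g).
  by rewrite scalerBr opprD addrACA.
apply: le_lt_trans (piZD _ _ _ _) _.
rewrite [ltRHS]splitr; apply: ler_ltD; last first.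
  by near: k; apply: vg; rewrite divr_gt0.
apply: (@le_trans _ _ ((Normc.normc c + 1) * pi n (u k - f : S))).
  by rewrite ler_wpM2r ?Defs.pi_ge0// lerDl.
rewrite mulrC -ler_pdivlMr//; apply: ltW; near: k.
by apply: uf; rewrite !divr_gt0.
Unshelve. all: by end_near. Qed.

Lemma seminorm_bounded_continuous (T : S -> S) : linear T ->
  (forall n, exists m (C : R), forall f, pi n (T f) <= C * pi m f) ->
  continuous T.
Proof.
move=> linT bT f A [n [e [e0 An]]].
have [m [C TC]] := bT n.
have C1 : 0 < `|C| + 1 by rewrite ltr_wpDl.
exists m, (e / (`|C| + 1)); split; first by rewrite divr_gt0.
move=> g fg; apply: An; rewrite /schwartz_ball /mkset.
have -> : (T g - T f : S) = T (g - f).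
  by have := linT (-1) f g; rewrite !scaleN1r [- f + g]addrC [- T f + _]addrC.
apply: le_lt_trans (TC _) _.
apply: (@le_lt_trans _ _ ((`|C| + 1) * pi m (g - f : S))).
  by rewrite ler_wpM2r ?Defs.pi_ge0// (le_trans (ler_norm C))// lerDl.
by rewrite mulrC -ltr_pdivlMr.
Qed.

Definition schwartz_cauchy u : Prop := forall n (e : R), 0 < e ->
  exists K, forall k m, (K <= k)%N -> (K <= m)%N -> pi n (u k - u m : S) <= e.

(** The real and imaginary parts of the derivatives are Cauchy sequences of reals at
each point.  Their limits assemble into a smooth function by
[smooth_pointwise_limit]; the weighted bounds, which compare two terms of the
sequence at a point, then pass to the limit in the second term. *)
Lemma schwartz_complete u : schwartz_cauchy u -> exists f, u @ \oo --> f.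
Proof.
move=> cu.
(* [p] stands for the real or the imaginary part. *)
have component (p : R[i] -> R) :
    (forall c d, p (c - d) = p c - p d) ->
    (forall z, `|p z| <= Normc.normc z) ->
    (forall j k x, (p \o u k)^`(j)%classic x = p (cderivn j (u k) x)) ->
    (forall k, smooth (p \o u k)) ->
    exists2 G : nat -> R -> R,
      smooth (G 0%N) /\ (forall j, (G 0%N)^`(j)%classic = G j) &
      forall j x, p (cderivn j (u k) x) @[k --> \oo] --> G j x.
  move=> pB p_le pE ps.
  have diff_le j k m x :
      `|p (cderivn j (u k) x) - p (cderivn j (u m) x)| <= pi j (u k - u m : S).
    rewrite -pB -cderivnB; exact: le_trans (p_le _) (normc_cderivn_le _ _ _).
  have cvgp j x : cvg (p (cderivn j (u k) x) @[k --> \oo]).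
    apply/cauchy_cvgP/cauchyP => e e0.
    have [K uK] := cu j (e / 2) (divr_gt0 e0 (ltr0n _ 2)).
    exists (p (cderivn j (u K) x)); exists K => // k /= Kk.
    rewrite -ball_normE /=; apply: le_lt_trans (diff_le _ _ _ _) _.
    apply: (@le_lt_trans _ _ (e / 2)); last by rewrite ltr_pdivrMr// ltr_pMr// ltr1n.
    exact: uK.
  exists (fun j x => lim (p (cderivn j (u k) x) @[k --> \oo])); last exact: cvgp.
  apply: (@smooth_pointwise_limit _ (fun k => p \o u k)); first exact: ps.
    by move=> j x; under eq_fun do rewrite pE; exact: cvgp.
  move=> j; have [K uK] := cu j 1 ltr01; exists (1 + pi j (u K)).
  exists K => // k /= Kk x; rewrite pE (le_trans (p_le _))//.
  apply: le_trans (normc_cderivn_le _ _ (leqnn j)) _.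
  rewrite -[u k](subrK (u K)) (le_trans (piD _ _ _))// lerD2r.
  exact: uK.
have [Gr [sr Er] cr] : exists2 G : nat -> R -> R,
      smooth (G 0%N) /\ (forall j, (G 0%N)^`(j)%classic = G j) &
      forall j x, complex.Re (cderivn j (u k) x) @[k --> \oo] --> G j x.
  apply: component; [by move=> [? ?] [? ?] | exact: normc_Re_le | by [] |].
  by move=> k; exact: (proj1 (proj1 (schwartz_is (u k)))).
have [Gi [si Ei] ci] : exists2 G : nat -> R -> R,
      smooth (G 0%N) /\ (forall j, (G 0%N)^`(j)%classic = G j) &
      forall j x, complex.Im (cderivn j (u k) x) @[k --> \oo] --> G j x.
  apply: component; [by move=> [? ?] [? ?] | exact: normc_Im_le | by [] |].
  by move=> k; exact: (proj2 (proj1 (schwartz_is (u k)))).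
pose F : R -> R[i] := fun x => Gr 0%N x +i* Gi 0%N x.
have sF : csmooth F by split; [exact: sr | exact: si].
have FE j x : cderivn j F x = Gr j x +i* Gi j x.
  by rewrite /cderivn -(Er j) -(Ei j).
have value_le n j x k (e : R) : (j <= n)%N ->
    (\forall m \near \oo, pi n (u k - u m : S) <= e) ->
    (1 + `|x| ^+ 2) ^+ n * Normc.normc (cderivn j (u k) x - cderivn j F x) <= e.
  move=> jn ue.
  have lim_value : (1 + `|x| ^+ 2) ^+ n *
      Normc.normc (cderivn j (u k) x - cderivn j (u m) x) @[m --> \oo] -->
      (1 + `|x| ^+ 2) ^+ n * Normc.normc (cderivn j (u k) x - cderivn j F x).
    apply: cvgM; first exact: cvg_cst.
    have ReB (c d : R[i]) : complex.Re (c - d) = complex.Re c - complex.Re d.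
      by case: c d => [? ?] [? ?].
    have ImB (c d : R[i]) : complex.Im (c - d) = complex.Im c - complex.Im d.
      by case: c d => [? ?] [? ?].
    apply: cvg_normc.
      under eq_fun do rewrite ReB; rewrite ReB FE.
      by apply: cvgB; [exact: cvg_cst | exact: cr].
    under eq_fun do rewrite ImB; rewrite ImB FE.
    by apply: cvgB; [exact: cvg_cst | exact: ci].
  apply: (cvgr_to_le lim_value); apply: filterS ue => m.
  rewrite -cderivnB; apply: le_trans.
  exact: (seminorm_ub x (schwartz_is (u k - u m)) jn).
have schF : is_schwartz F.
  split=> // n; have [K uK] := cu n 1 ltr01.
  exists (pi n (u K) + 1) => _ [x [j [jn ->]]].
  apply: (@le_trans _ _ ((1 + `|x| ^+ 2) ^+ n * (Normc.normc (cderivn j (u K) x)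
     + Normc.normc (cderivn j (u K) x - cderivn j F x)))).
    rewrite ler_wpM2l ?weight_ge0// -[X in _ + X]normcN opprB.
    by rewrite -[X in Normc.normc X <= _](subrK (cderivn j (u K) x)) addrC le_normcD.
  rewrite mulrDr lerD//; first exact/seminorm_ub/jn/schwartz_is.
  by apply: value_le => //; exists K => // m /= Km; exact: uK.
pose f : S := Schwartz (introT (schwartzP _) schF).
exists f; apply/schwartz_cvgP => n e e0.
have [K uK] := cu n (e / 2) (divr_gt0 e0 (ltr0n _ 2)).
exists K => // k /= Kk.
apply: (@le_lt_trans _ _ (e / 2)); last by rewrite ltr_pdivrMr// ltr_pMr// ltr1n.
apply: seminorm_le => x j jn; rewrite (cderivnB j (u k) f).
by apply: value_le => //; exists K => // m /= Km; exact: uK.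
Qed.

End SchwartzLimits.

(** * Uniform boundedness *)

Lemma normc_real (R : rcfType) (s : R) : Normc.normc s%:C = `|s|.
Proof. by rewrite /= expr0n addr0 sqrtr_sqr. Qed.

Lemma normcX (R : rcfType) (z : R[i]) k :
  Normc.normc (z ^+ k) = Normc.normc z ^+ k.
Proof.
elim: k => [|k IH]; first by rewrite !expr0 Normc.normc1.
by rewrite !exprS Normc.normcM IH.
Qed.

Section LinearProp.
Context {K : pzRingType} {X Y : lmodType K} {T : X -> Y} (linT : linear T).

Let L : {linear X -> Y} := HB.pack T (GRing.isLinear.Build K X Y _ T linT).

Lemma lin0 : T 0 = 0. Proof. exact: (raddf0 L). Qed.
Lemma linB : {morph T : f g / f - g}. Proof. exact: (raddfB L). Qed.
Lemma linD : {morph T : f g / f + g}. Proof. exact: (raddfD L). Qed.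
Lemma linN : {morph T : f / - f}. Proof. exact: (raddfN L). Qed.
Lemma linZ c : {morph T : f / c *: f}. Proof. exact: (linearZZ L). Qed.

End LinearProp.

Lemma linear_iter (K : pzRingType) (X : lmodType K) (T : X -> X) k :
  linear T -> linear (iter k T).
Proof.
by move=> linT; elim: k => [//|k IH] c f g /=; rewrite IH linT.
Qed.

Lemma continuous_iter (X : topologicalType) (T : X -> X) k :
  continuous T -> continuous (iter k T).
Proof.
move=> cT; elim: k => [|k IH] x; first by move=> A.
by apply: (@continuous_comp _ _ _ (iter k T) T); [exact: IH | exact: cT].
Qed.

Section SchwartzOperators.
Context {R : realType}.
Local Notation S := (schwartz R).
Local Notation pi := schwartz_seminorm.
Implicit Types (f g h : S) (u v : nat -> S).

(** The Baire step of the Banach-Steinhaus principle.  If the family is bounded on no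
ball, each ball contains a smaller one on which some [T i] exceeds
[k * w i].  The nested balls shrink in every seminorm, so their centres
converge, and the family is unbounded at the limit. *)
Lemma bounded_somewhere (I : Type) (T : I -> S -> S) (w : I -> R) n :
  (forall i, 0 <= w i) -> (forall i, continuous (T i)) ->
  (forall f, exists B : R, forall i, pi n (T i f) <= B * w i) ->
  exists g m (e K : R), 0 < e /\
    forall h, pi m (h - g : S) <= e -> forall i, pi n (T i h) <= K * w i.
Proof.
move=> w0 cT ptwise; apply: contrapT => unbounded.
have {}unbounded g m (e K : R) : 0 < e ->
    exists h i, pi m (h - g : S) <= e /\ K * w i < pi n (T i h).
  move=> e0; apply: contrapT => bounded; apply: unbounded.
  exists g, m, e, K; split=> // h hg i; rewrite leNgt; apply/negP => lt.
  by apply: bounded; exists h, i.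
(* A triple [(g, m, e)] encodes the ball [inball] of centre [g] and radius [e] for
   the seminorm of index [m]. *)
pose X := (S * nat * {posnum R})%type.
pose inball (x : X) h := pi x.1.2 (h - x.1.1 : S) <= x.2%:num.
have step (z : nat * X) : exists y : X, [/\
    forall h, inball y h -> inball z.2 h, (z.1 <= y.1.2)%N,
    y.2%:num <= z.1.+1%:R^-1 &
    exists i, forall h, inball y h -> z.1%:R * w i < pi n (T i h)].
  case: z => k [[g m] e] /=.
  have e0 : 0 < e%:num / 2 by [].
  have [h [i [hg Th]]] := unbounded g m (e%:num / 2) k%:R e0.
  pose d := pi n (T i h) - k%:R * w i.
  have d0 : 0 < d by rewrite subr_gt0.
  have nd : nbhs (T i h) (schwartz_ball n (T i h) d) by exists n, d; split.
  have [m' [e' [e'0 Tm']]] := cT i h _ nd.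
  (* One half of [e] keeps the new closed ball inside the old one; one half of
     [e'] because [Tm'] speaks of an open ball. *)
  pose r := Order.min (e%:num / 2) (Order.min (e' / 2) k.+1%:R^-1).
  have r0 : 0 < r by rewrite !lt_min !divr_gt0//= invr_gt0.
  exists (h, maxn m (maxn m' k), PosNum r0); rewrite /inball /=; split.
  - move=> h' hh'; apply: le_trans (piBD m h h' g) _.
    rewrite [leRHS]splitr lerD//.
    apply: le_trans (pi_mono _ (leq_maxl m (maxn m' k))) _.
    by apply: le_trans hh' _; rewrite ge_min lexx.
  - by rewrite !leq_max leqnn !orbT.
  - by rewrite !ge_min lexx !orbT.
  - exists i => h' hh'.
    have /Tm' : schwartz_ball m' h e' h'.
      rewrite /schwartz_ball /mkset.
      have m'le : (m' <= maxn m (maxn m' k))%N by rewrite !leq_max leqnn !orbT.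
      apply: le_lt_trans (pi_mono _ m'le) _.
      apply: le_lt_trans hh' _; rewrite !gt_min.
      by rewrite [e' / 2 < e']ltr_pdivrMr// ltr_pMr// ltr1n orbT.
    rewrite /schwartz_ball /mkset /= piBC /d => lt.
    have := piBD n (T i h') (T i h) 0; rewrite !subr0 => le.
    by lra.
have [F FP] := choice step.
have [x xP] : exists x : nat -> X, forall k, [/\
    forall h, inball (x k.+1) h -> inball (x k) h, (k <= (x k.+1).1.2)%N,
    (x k.+1).2%:num <= k.+1%:R^-1 &
    exists i, forall h, inball (x k.+1) h -> k%:R * w i < pi n (T i h)].
  pose x0 : X := (0, 0%N, PosNum ltr01).
  exists (fix x k := if k is k'.+1 then F (k', x k') else x0) => k.
  exact: FP (k, _).
have nested k j h : inball (x (k + j)%N) h -> inball (x k) h.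
  elim: j => [|j IH]; first by rewrite addn0.
  by rewrite addnS => xh; apply: IH; have [+ _ _ _] := xP (k + j)%N; apply.
have center k j : (k <= j)%N -> inball (x k) (x j).1.1.
  move=> kj; apply: (@nested k (j - k)%N); rewrite subnKC//.
  by rewrite /inball subrr pi0.
have cauchy_centers : schwartz_cauchy (fun k => (x k).1.1).
  move=> N e e0.
  pose K := maxn N (Num.truncn (2 / e)).
  have [_ Kx xK _] := xP K.
  have {}xK : (x K.+1).2%:num <= e / 2.
    apply: le_trans xK _; rewrite -[leRHS]invf_div lef_pV2 ?posrE ?divr_gt0//.
    apply: le_trans (ltW (truncnS_gt _)) _.
    by rewrite ler_nat ltnS leq_maxr.
  exists K.+1 => k j Kk Kj; set f := (X in pi N (schwartz_fun X)).
  have NK : (N <= (x K.+1).1.2)%N by apply: leq_trans Kx; exact: leq_maxl.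
  apply: le_trans (pi_mono f NK) _.
  apply: le_trans (piBD _ (x K.+1).1.1 _ _) _.
  rewrite [e]splitr lerD//; first exact: le_trans (center _ _ Kk) xK.
  by rewrite piBC; exact: le_trans (center _ _ Kj) xK.
have [G xG] := schwartz_complete cauchy_centers.
have inG k : inball (x k) G.
  by apply: (seminorm_lim_le xG); exists k => // j /= kj; exact: center.
have [B TB] := ptwise G.
pose k := (Num.truncn B).+1.
have [_ _ _ [i /(_ G)]] := xP k.
move=> /(_ (inG k.+1)); apply/negP; rewrite -leNgt.
apply: le_trans (TB i) _; rewrite ler_wpM2r//=.
exact: ltW (truncnS_gt _).
Qed.

(** The weights [w] let the family grow with the index, so that it can be the
family of all iterates of one operator.  An estimate on the ball around [g]
yields one around the origin by subtracting the value at [g], and homogeneity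
turns it into an estimate by the seminorm. *)
Lemma uniform_boundedness (I : Type) (T : I -> S -> S) (w : I -> R) n :
  (forall i, 0 <= w i) -> (forall i, continuous_linear (T i)) ->
  (forall f, exists B : R, forall i, pi n (T i f) <= B * w i) ->
  exists m (C : R), forall i f, pi n (T i f) <= C * w i * pi m f.
Proof.
move=> w0 clT ptwise.
have [g [m [e [K [e0 bound]]]]] :=
  bounded_somewhere w0 (fun i => proj2 (clT i)) ptwise.
exists m, (2 * K / e) => i f; have linT := proj1 (clT i).
have [f0|f0] := eqVneq (pi m f) 0.
  have -> : f = 0.
    apply: pi_eq0; apply/eqP; rewrite eq_le Defs.pi_ge0 andbT -f0.
    exact: pi_mono.
  by rewrite (lin0 linT) !pi0 mulr0.
have {}f0 : 0 < pi m f by rewrite lt_def f0 Defs.pi_ge0.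
(* The factor that scales [f] to the radius of the ball. *)
pose s := e / pi m f; have s0 : 0 < s by rewrite divr_gt0.
pose h : S := g + s%:C *: f.
have hg : pi m (h - g : S) <= e.
  rewrite addrC addKr; apply: le_trans (piZ _ _ _) _.
  by rewrite normc_real gtr0_norm// divfK// gt_eqF.
have gg : pi m (g - g : S) <= e by rewrite subrr pi0 ltW.
have -> : T i f = (s^-1)%:C *: (T i h - T i g).
  rewrite -(linB linT) addrC addKr (linZ linT) scalerA -rmorphM/=.
  by rewrite mulVf ?gt_eqF// scale1r.
apply: le_trans (piZ _ _ _) _; rewrite normc_real gtr0_norm ?invr_gt0//.
have -> : 2 * K / e * w i * pi m f = s^-1 * (K * w i + K * w i).
  by rewrite /s invf_div; ring.
rewrite ler_wpM2l ?invr_ge0 ?(ltW s0)//.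
by apply: le_trans (piB _ _ _) _; rewrite lerD ?bound.
Qed.

(** * The Neumann series *)

(** The bound is uniform in [q]: for [p = 0] it controls the distance from the limit
to [u 0], and as [p] grows it gives the Cauchy condition. *)
Lemma geometric_dist n u (D r : R) : 0 <= r < 1 ->
  (forall k, pi n (u k.+1 - u k : S) <= D * r ^+ k) ->
  forall p q, pi n (u (p + q)%N - u p : S) <= D / (1 - r) * r ^+ p.
Proof.
move=> /andP[r0 r1] uD p q.
have D0 : 0 <= D by have := uD 0%N; rewrite mulr1; apply/le_trans/Defs.pi_ge0.
have r1' : 0 < 1 - r by rewrite subr_gt0.
(* The stronger bound by the exact geometric sum goes through the induction. *)
suff : pi n (u (p + q)%N - u p : S) <=
    D / (1 - r) * (r ^+ p - r ^+ (p + q)).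
  move=> /le_trans; apply; rewrite ler_wpM2l//.
    by rewrite divr_ge0// ltW.
  by rewrite lerBlDr lerDl exprn_ge0.
elim: q => [|q IH]; first by rewrite addn0 !subrr pi0 mulr0.
rewrite addnS; apply: le_trans (piBD _ (u (p + q)%N) _ _) _.
apply: le_trans (lerD (uD _) IH) _.
suff -> : D * r ^+ (p + q) = D / (1 - r) * (r ^+ (p + q) - r ^+ (p + q).+1).
  by rewrite -mulrDr [_ - _ + _]addrC addrA subrK.
by rewrite exprS; field; rewrite gt_eqF.
Qed.

Lemma geometric_cvg u (r : R) : 0 <= r < 1 ->
  (forall n, exists D : R, forall k, pi n (u k.+1 - u k : S) <= D * r ^+ k) ->
  exists f, u @ \oo --> f.
Proof.
move=> r01 ub; apply: schwartz_complete => n e e0.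
have [D uD] := ub n; have /andP[r0 r1] := r01.
have : D / (1 - r) * r ^+ k @[k --> \oo] --> 0.
  by apply: (@cvg_geometric R); rewrite ger0_norm.
move=> /(cvgr_lt 0) /(_ (e / 2)) /(_ (divr_gt0 e0 (ltr0n _ 2))) [K _ KP].
have near_K k : (K <= k)%N -> pi n (u k - u K : S) <= e / 2.
  move=> Kk; rewrite -(subnKC Kk); apply: le_trans (geometric_dist r01 uD _ _) _.
  exact/ltW/KP/leqnn.
exists K => k m Kk Km; apply: le_trans (piBD n (u K) _ _) _.
rewrite [e]splitr; apply: lerD; first exact: near_K.
by rewrite piBC; exact: near_K.
Qed.

(** The Neumann series [V = sum_k l^-(k+1) T^k] converges and inverts [l - T]: its
partial sums telescope to [f - l^-k T^k f] on [l f - T f], and [V] commutes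
with [T].  Hence [- V] inverts [T - l]. *)
Lemma geometric_growth_not_spectrum (T : S -> S) (l : R[i]) (mu : R) :
  continuous_linear T -> 0 <= mu < Normc.normc l ->
  (forall n, exists m (C : R), forall k f,
     pi n (iter k T f) <= C * mu ^+ k * pi m f) ->
  ~ spectrum T l.
Proof.
move=> [linT cT] /andP[mu0 mul] growth.
have l0 : 0 < Normc.normc l := le_lt_trans mu0 mul.
have ln0 : l != 0 by apply: contraTneq l0 => ->; rewrite Normc.normc0 ltxx.
pose r := mu / Normc.normc l.
have r01 : 0 <= r < 1.
  by rewrite divr_ge0 ?(ltW l0)//= ltr_pdivrMr// mul1r.
pose U k f : S := \sum_(j < k) l^-1 ^+ j.+1 *: iter j T f.
have US k f : U k.+1 f = U k f + l^-1 ^+ k.+1 *: iter k T f.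
  by rewrite /U big_ord_recr.
have US_le n : exists m (C : R), forall f k,
    pi n (U k.+1 f - U k f : S) <= (C * pi m f) * r ^+ k.
  have [m [C TC]] := growth n; exists m, (C / Normc.normc l) => f k.
  rewrite US addrC addKr; apply: le_trans (piZ _ _ _) _.
  rewrite normcX Normc.normcV.
  apply: (le_trans (ler_wpM2l _ (TC k f))).
    by rewrite exprn_ge0// invr_ge0 ltW.
  by rewrite exprS /r expr_div_n exprVn le_eqVlt; apply/orP; left; apply/eqP; ring.
have /choice[V UV] f : exists g, U k f @[k --> \oo] --> g.
  apply: (geometric_cvg r01) => n.
  by have [m [C H]] := US_le n; exists (C * pi m f) => k; exact: H.
have linU k : linear (U k).
  move=> c f g; rewrite /U scaler_sumr -big_split /=; apply: eq_bigr => j _.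
  by rewrite (linear_iter j linT) scalerDr !scalerA mulrC.
have linV : linear V.
  move=> c f g; apply: (schwartz_cvg_unique (UV _)).
  under eq_fun do rewrite linU; exact: schwartz_cvgZD.
have bV n : exists m (C : R), forall f, pi n (V f) <= C * pi m f.
  have [m [C UC]] := US_le n; exists m, (C / (1 - r)) => f.
  rewrite -[V f]subr0; apply: (seminorm_lim_le (UV f)); exists 0%N => // k _ /=.
  have := geometric_dist r01 (UC f) 0 k; rewrite add0n {2}/U big_ord0.
  by rewrite expr0 mulr1 mulrAC.
have telescope k f : U k (l *: f - T f) = f - l^-1 ^+ k *: iter k T f.
  elim: k => [|k IH]; first by rewrite /U big_ord0 scale1r subrr.
  have linTk := linear_iter k linT.
  rewrite US IH (linB linTk) (linZ linTk) scalerBr scalerA exprSr.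
  by rewrite -mulrA mulVf// mulr1 addrA subrK -iterSr.
have VlT f : V (l *: f - T f) = f.
  apply: (schwartz_cvg_unique (UV _)); apply: schwartz_cvg_squeeze => n.
  have [m [C TC]] := growth n; exists (fun k => C * pi m f * r ^+ k).
    apply: (@cvg_geometric R); have /andP[r0 r1] := r01.
    by rewrite ger0_norm.
  move=> k; rewrite telescope addrC addKr piN; apply: le_trans (piZ _ _ _) _.
  rewrite normcX Normc.normcV.
  apply: (le_trans (ler_wpM2l _ (TC k f))).
    by rewrite exprn_ge0// invr_ge0 ltW.
  by rewrite /r expr_div_n exprVn le_eqVlt; apply/orP; left; apply/eqP; ring.
have VT f : V (T f) = T (V f).
  apply: (schwartz_cvg_unique (UV _)).
  have -> : (fun k => U k (T f)) = T \o (U ^~ f).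
    apply/funext => k /=; elim: k => [|k IH].
      by rewrite /U !big_ord0 (lin0 linT).
    by rewrite !US (linD linT) (linZ linT) IH -iterSr.
  exact: (continuous_cvg _ (cT (V f)) (UV f)).
have lTV f : l *: V f - T (V f) = f.
  by rewrite -VT -(linZ linV) -(linB linV); exact: VlT.
apply; exists (fun f => - V f).
  have linNV : linear (fun f => - V f).
    by move=> c f g; rewrite linV opprD scalerN.
  split; first exact: linNV.
  apply: (seminorm_bounded_continuous linNV) => n.
  by have [m [C VC]] := bV n; exists m, C => f; rewrite piN.
split=> f.
  by rewrite -(linN linV) opprB.
by rewrite (linN linT) scalerN opprK addrC.
Qed.

(** An orbit term is a difference of two consecutive orbit sums, and the sum of
length [k] is [k] times a Cesàro mean, which stays bounded. *)
Lemma mean_ergodic_growth (T : S -> S) n f : mean_ergodic T ->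
  exists B : R, forall k, pi n (iter k T f) <= B * k.+1%:R.
Proof.
move=> [P _ /(_ f) /schwartz_cvgP /(_ n 1 ltr01) [K _ KP]].
pose B0 := 1 + pi n (P f).
have mean_le k : (K <= k)%N -> pi n (cesaro_mean T k f) <= B0.
  move=> /KP /ltW; rewrite -[cesaro_mean T k f](subrK (P f)) => le.
  by apply: le_trans (piD _ _ _) _; rewrite lerD2r; rewrite subrK in le.
have sum_le k : (K <= k)%N ->
    pi n (\sum_(1 <= j < k.+1) iter j T f : S) <= B0 * k%:R.
  move=> Kk; have [->|k0] := posnP k.
    by rewrite big_geq// pi0 mulr0.
  have -> : \sum_(1 <= j < k.+1) iter j T f = (k%:R)%:C *: cesaro_mean T k f.
    rewrite /cesaro_mean scalerA rmorph_nat divff ?scale1r//.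
    by rewrite pnatr_eq0 -lt0n.
  apply: le_trans (piZ _ _ _) _; rewrite normc_real normr_nat mulrC.
  by rewrite ler_wpM2r// mean_le.
have B00 : 0 <= B0 by rewrite addr_ge0 ?Defs.pi_ge0.
(* [A] takes care of the indices below [K], where the means are not controlled. *)
pose A := \sum_(j < K.+1) pi n (iter j T f).
have A0 : 0 <= A by apply: sumr_ge0 => j _; exact: Defs.pi_ge0.
exists (A + 2 * B0) => k; have [kK|Kk] := leqP k K.
  apply: (@le_trans _ _ A).
    rewrite /A (bigD1 (Ordinal (kK : (k < K.+1)%N)))//= lerDl.
    by apply: sumr_ge0 => j _; exact: Defs.pi_ge0.
  apply: (@le_trans _ _ (A + 2 * B0)); first by rewrite lerDl mulr_ge0.
  by rewrite ler_peMr ?addr_ge0 ?mulr_ge0// ler1n.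
case: k Kk => // k; rewrite ltnS => Kk.
have -> : iter k.+1 T f =
    \sum_(1 <= j < k.+2) iter j T f - \sum_(1 <= j < k.+1) iter j T f.
  by rewrite [X in _ = X - _]big_nat_recr//= addrC addrK.
apply: le_trans (piB _ _ _) _.
apply: le_trans (lerD (sum_le _ (leqW Kk)) (sum_le _ Kk)) _.
rewrite -[k.+2]addn2 -[k.+1]addn1 !natrD.
have k0 : 0 <= k%:R :> R by [].
by nra.
Qed.

End SchwartzOperators.

(** * The spectrum of a mean ergodic composition operator *)

Lemma bernoulli_ineq (R : realDomainType) (d : R) k : 0 <= d ->
  1 + k%:R * d <= (1 + d) ^+ k.
Proof.
move=> d0; elim: k => [|k IH]; first by rewrite mul0r addr0.
have k0 : 0 <= k%:R :> R by [].
rewrite exprS; apply: (@le_trans _ _ ((1 + d) * (1 + k%:R * d))).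
  by rewrite -natr1; nra.
by rewrite ler_wpM2l// addr_ge0.
Qed.

(** The points [(1 - t) l] with small [t > 0] lie in the open disc and tend to [l]. *)
Lemma closed_disc_closure (R : realType) (l : R[i]) :
  Normc.normc l <= 1 -> closure (@unit_disc R) l.
Proof.
move=> l1 A; rewrite -nbhs_ballE => -[e /= e0 eA].
have eE : e = (complex.Re e)%:C.
  by case: (e) e0 => a b; rewrite ltcE /= => /andP[/eqP -> _].
have Re0 : 0 < complex.Re e by move: e0; rewrite {1}eE ltcR.
pose t := Order.min (1 / 2) (complex.Re e / 2).
have t0 : 0 < t by rewrite lt_min !divr_gt0.
have t1 : t < 1.
  by rewrite gt_min ltr_pdivrMr// mul1r ltr1n.
have te : t < complex.Re e.
  by rewrite gt_min [X in _ || X]ltr_pdivrMr// ltr_pMr// ltr1n orbT.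
exists ((1 - t)%:C * l); split.
  rewrite /unit_disc /=; change ((Normc.normc ((1 - t)%:C * l))%:C < 1%:C).
  rewrite ltcR Normc.normcM normc_real gtr0_norm ?subr_gt0//.
  apply: (@le_lt_trans _ _ ((1 - t) * 1)).
    by rewrite ler_wpM2l// subr_ge0 ltW.
  by rewrite mulr1 gtrBl.
apply: eA; rewrite -ball_normE /= eE.
change ((Normc.normc (l - (1 - t)%:C * l))%:C < (complex.Re e)%:C).
have -> : l - (1 - t)%:C * l = t%:C * l.
  by rewrite rmorphB/= mulrBl mul1r opprB addrC subrK.
rewrite ltcR Normc.normcM normc_real gtr0_norm//.
by apply: le_lt_trans te; rewrite ler_piMr// ltW.
Qed.

Theorem corollary4p1 (R : realType) (phi : R -> R) :
  is_symbol phi ->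
  mean_ergodic (composition_op phi) ->
  spectrum (composition_op phi) `<=` closure (@unit_disc R).
Proof.
move=> sphi ergT l specl; set T := composition_op phi in ergT specl.
have clT : continuous_linear T.
  by split; [exact: composition_op_linear | case: sphi].
apply: closed_disc_closure; rewrite leNgt; apply/negP => l1.
(* The growth rate [mu = 1 + d] is halfway between [1] and [|l|]. *)
pose d := (Normc.normc l - 1) / 2.
have d0 : 0 < d by rewrite divr_gt0// subr_gt0.
have mul : 0 <= 1 + d < Normc.normc l by rewrite /d; apply/andP; split; lra.
have growth n : exists m (C : R), forall k f,
    schwartz_seminorm n (iter k T f) <= C * (1 + d) ^+ k * schwartz_seminorm m f.
  apply: (@uniform_boundedness R nat (fun k => iter k T)).
  - by move=> k; rewrite exprn_ge0// addr_ge0// ltW.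
  - move=> k; split; first exact/linear_iter/(proj1 clT).
    exact/continuous_iter/(proj2 clT).
  - move=> f; have [B TB] := mean_ergodic_growth n f ergT.
    have B0 : 0 <= B by have := le_trans (Defs.pi_ge0 _ _) (TB 0%N); rewrite mulr1.
    exists (B * (1 + d^-1)) => k; apply: le_trans (TB k) _.
    rewrite -mulrA ler_wpM2l//.
    have bk : k%:R * d <= (1 + d) ^+ k.
      by apply: le_trans (bernoulli_ineq k (ltW d0)); rewrite lerDr.
    have b1 : 1 <= (1 + d) ^+ k by rewrite exprn_ege1// lerDl ltW.
    rewrite -natr1 mulrDl mul1r addrC lerD//.
    by rewrite mulrC ler_pdivlMr.
exact: geometric_growth_not_spectrum clT mul growth specl.
Qed.
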